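(* Let $M^t,N^t$ ($t\in\mathbf{R}$) be $1$-parameter subgroups of $\mathrm{GL}(n,\mathbf{R})$ such that $M=M^1$ and $N=N^1$ have no eigenvalues on the unit circle. If there exist a bijection $f:\mathbf{R}^n\to\mathbf{R}^n$ and constants $K\ge 1$, $C\ge 0$ such that for each $t\in\mathbf{R}$ and all $p,q\in\mathbf{R}^n$ $$-C+\frac1K\, d_{M,t}(p,q)\le d_{N,t}(f(p),f(q))\le K\, d_{M,t}(p,q)+C,$$ then $M$ and $N$ have the same absolute Jordan form.
   Context: For a $1$-parameter subgroup $M^t$ of $\mathrm{GL}(n,\mathbf{R})$ and $t\in\mathbf{R}$, $d_{M,t}$ is the metric on $\mathbf{R}^n$ determined by the quadratic form $Q_M(t)=(M^{-t})^T(M^{-t})$, i.e. $d_{M,t}(x,y)=\|M^{-t}(x-y)\|$ with $\|\cdot\|$ the Euclidean norm. The absolute Jordan form of $M\in \mathrm{GL}(n,\mathbf{R})$ is the matrix obtained from the Jordan form of $M$ over $\mathbf{C}$ by replacing each diagonal entry by its absolute value and rearranging the Jordan blocks in a canonical order (by decreasing diagonal entry, and for equal diagonal entries by decreasing block size). *)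

(* Defs.v *)
From HB Require Import structures.
From mathcomp Require Import all_boot all_order all_algebra.
From mathcomp Require Import all_classical all_reals topology normedtype.
From mathcomp Require Import complex.

Set Implicit Arguments.
Unset Strict Implicit.
Unset Printing Implicit Defensive.

Import Order.TTheory GRing.Theory Num.Theory.
Import numFieldNormedType.Exports.

Local Open Scope ring_scope.

Definition one_parameter_subgroup (R : realType) (n : nat)
    (M : R -> 'M[R]_n) : Prop :=
  [/\ forall t, M t \in unitmx,
      forall s t, M (s + t) = M s *m M t
    & continuous M].

(* The library norm on matrices is the sup norm, hence an explicit l^2 norm. *)
Definition euclidean_norm (R : realType) (n : nat) (v : 'cV[R]_n) : R :=
  Num.sqrt (\sum_(i < n) v i 0 ^+ 2).

Definition dist (R : realType) (n : nat) (M : R -> 'M[R]_n) (t : R)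
    (x y : 'cV[R]_n) : R :=
  euclidean_norm (M (- t) *m (x - y)).

Definition complexify (R : realType) (n : nat) (A : 'M[R]_n) : 'M[R[i]]_n :=
  map_mx (real_complex R) A.

Definition no_unit_circle_eigenvalue (R : realType) (n : nat)
    (A : 'M[R]_n) : Prop :=
  forall z : R[i], eigenvalue (complexify A) z -> ComplexField.Normc.normc z != 1.

Definition jordan_block (F : fieldType) (a : F) (k : nat) : 'M[F]_k :=
  \matrix_(i < k, j < k)
    (if i == j then a else if j == i.+1 :> nat then 1 else 0).

(* A pair (a, k) in s stands for the Jordan block of size k with diagonal
   entry a; jordan_mx s puts the blocks on the diagonal in the order of s. *)
Definition jordan_size (F : fieldType) (s : seq (F * nat)) : nat :=
  (\sum_(i < size s) (nth (0%R, 0) s i).2)%N.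

Definition jordan_mx (F : fieldType) (s : seq (F * nat)) :
    'M[F]_(jordan_size s) :=
  \mxdiag_(i < size s)
     jordan_block (nth (0, 0%N) s i).1 (nth (0, 0%N) s i).2.

Definition jordan_form_of (F : fieldType) (n : nat) (A : 'M[F]_n)
    (s : seq (F * nat)) : Prop :=
  all (fun b => 0 < b.2)%N s /\
  exists e : jordan_size s = n,
    A ~_{in unitmx} castmx (e, e) (jordan_mx s).

Definition block_ge (R : realType) (b c : R * nat) : bool :=
  (c.1 < b.1) || ((b.1 == c.1) && (c.2 <= b.2)%N).

Definition abs_blocks (R : realType) (s : seq (R[i] * nat)) : seq (R * nat) :=
  sort (@block_ge R) [seq (ComplexField.Normc.normc b.1, b.2) | b <- s].

Definition abs_jordan_form_of (R : realType) (n : nat) (A J : 'M[R]_n) : Prop :=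
  exists2 s : seq (R[i] * nat), jordan_form_of (complexify A) s &
    exists e : jordan_size (abs_blocks s) = n,
      J = castmx (e, e) (jordan_mx (abs_blocks s)).

(* The Jordan form is unique up to the order of its blocks and the blocks are
   then sorted, so J is determined by A; sharing one J is equality of the two
   absolute Jordan forms. *)
Definition same_abs_jordan_form (R : realType) (n : nat) (A B : 'M[R]_n) :
    Prop :=
  exists J : 'M[R]_n, abs_jordan_form_of A J /\ abs_jordan_form_of B J.

(* Main.v *)
Require Import Defs.
From HB Require Import structures.
From mathcomp Require Import all_boot all_order all_algebra.
From mathcomp Require Import all_classical all_reals topology normedtype.
From mathcomp Require Import complex.
From mathcomp Require Import zify ring lra.

Set Implicit Arguments.
Unset Strict Implicit.
Unset Printing Implicit Defensive.

Import Order.TTheory GRing.Theory Num.Theory.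
Import numFieldNormedType.Exports.

Local Open Scope ring_scope.

(** Write [A] and [B] for the complexifications of [M 1] and [N 1].  At
    [t = - m] the metric of [M] measures [A ^ m], at [t = m] it measures
    [A ^ - m]; integer times suffice.

    Fix [r > 1] and [k].  The vectors [v] with
    [|A ^ m v| = O(r ^ m (m + 1) ^ (k - 1))] form a subspace [U(r, k)] of the
    complex column vectors.  As [r > 1], an additive constant is itself
    [O(r ^ m (m + 1) ^ (k - 1))], so the hypothesis on [f] turns a bound of
    this kind on [p - q] into the same kind of bound on [f p - f q]; thus [f],
    extended to complex vectors as described below, maps
    cosets of the [U(r, k)] of [A] onto cosets of the [U(r, k)] of [B]
    (lemma [slow_coarse]).  At [t = 0] it is moreover a quasi-isometry of
    Euclidean spaces, and quasi-isometric Euclidean spaces have the same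
    dimension, by counting grid points ([coarse_card]).  So the two spaces
    [U(r, k)] have the same dimension ([flag_card_le]).

    In a Jordan basis a vector whose topmost nonzero coordinate in a block of
    eigenvalue [a] is at position [j], counted from [0], grows in that block
    like [|a| ^ m m ^ j].  Hence [U(r, k)] is the coordinate subspace of the
    positions [j] with [|a| < r], or [|a| = r] and [j < k]
    ([slow_of_flag], [flag_of_slow]).  Its dimension increases from [k] to
    [k + 1] by the number of blocks of modulus [r] and size greater than [k],
    so the dimensions determine the blocks of modulus greater than [1]
    ([perm_eq_of_weights]).  The powers of [A ^ -1] give the blocks of modulus
    less than [1] in the same way, and modulus [1] is excluded by hypothesis.

    The map [f] lives on real vectors while the Jordan coordinates are
    complex.  The map [x + i y |-> f x + i f y] satisfies the same kind of
    estimates as [f], and the whole argument is carried out for it over the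
    complex numbers. *)

Local Notation block s i := (nth (0%R, 0%N) s i).
Local Notation normc := ComplexField.Normc.normc.

(** * Jordan bases *)

Section JordanForm.
Variable F : fieldType.

Lemma mul_jordan_block (a : F) k m (P : 'M[F]_(k, m)) i j (x : nat -> F) :
    (forall l : 'I_k, P l j = x l) -> x k = 0 ->
  (jordan_block a k *m P) i j = a * x i + x i.+1.
Proof.
move=> Px xk; rewrite mxE (bigD1 i) //= mxE eqxx Px; congr (_ + _).
have [lt_ik|] := ltnP i.+1 k.
  rewrite (bigD1 (Ordinal lt_ik)) /=; last first.
    by rewrite -val_eqE /= gtn_eqF.
  rewrite mxE -val_eqE /= ltn_eqF // eqxx mul1r Px big1 ?addr0 // => l.
  rewrite -!val_eqE /= => /andP[li li1].
  by rewrite mxE -val_eqE eq_sym (negPf li) (negPf li1) mul0r.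
move=> k_le; have <- : k = i.+1 by apply/eqP; rewrite eqn_leq k_le ltn_ord.
rewrite xk big1 ?addr0 // => l li.
rewrite mxE eq_sym (negPf li); case: eqP => [lk|]; last by rewrite mul0r.
by move: (ltn_ord l) k_le; rewrite lk ltnNge => /negPf ->.
Qed.

Lemma col_mul m n p (A : 'M[F]_(m, n)) (B : 'M[F]_(n, p)) j :
  col j (A *m B) = A *m col j B.
Proof. by rewrite !colE mulmxA. Qed.

(** The kernels of the powers of [B] increase strictly and then become
    constant.  The vector [v] is taken at the last strict step, so that it
    generates a Jordan chain of maximal length. *)
Lemma kernel_chain_stabilizes n (B : 'M[F]_n) : ~~ row_free B ->
  exists k (v : 'rV[F]_n), [/\ v *m B ^+ k.+1 = 0, v *m B ^+ k != 0
    & forall w : 'rV[F]_n, w *m B ^+ k.+2 = 0 -> w *m B ^+ k.+1 = 0].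
Proof.
move=> nfB; pose stable k := \rank (B ^+ k.+1) == \rank (B ^+ k).
have rkS k : (\rank (B ^+ k.+1) <= \rank (B ^+ k))%N.
  by rewrite exprS -mulmxE mxrankM_maxr.
have exst : exists k, stable k.
  suff h r k : (\rank (B ^+ k) <= r)%N -> exists k, stable k by exact: (h _ 0%N).
  elim: r k => [|r IH] k.
    by move=> h; exists k; rewrite /stable eqn_leq rkS; apply: leq_trans h _.
  move=> h; have [st|ns] := boolP (stable k); first by exists k.
  by apply: (IH k.+1); rewrite -ltnS (leq_trans _ h) // ltn_neqAle rkS andbT.
case: (ex_minnP exst) => -[|k] st mink.
  by case/negP: nfB; move: st; rewrite /stable expr1 expr0 mxrank1.
have : ~~ (kermx (B ^+ k.+1) <= kermx (B ^+ k))%MS.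
  apply/negP => /mxrankS; rewrite !mxrank_ker => h.
  suff sk : stable k by have := mink k sk; rewrite ltnn.
  rewrite /stable eqn_leq rkS /=.
  have := rank_leq_row (B ^+ k); have := rank_leq_row (B ^+ k.+1).
  by move: h; lia.
case/row_subPn => i; set v := row i _ => nv.
exists k, v; split.
- by apply/sub_kermxP; rewrite row_sub.
- by apply: contra nv => /eqP/sub_kermxP.
move=> w /sub_kermxP w2; apply/sub_kermxP.
have sk : (kermx (B ^+ k.+1) <= kermx (B ^+ k.+2))%MS.
  by apply/sub_kermxP; rewrite [B ^+ k.+2]exprSr -mulmxE mulmxA mulmx_ker mul0mx.
apply: submx_trans w2 _.
by rewrite -(mxrank_leqif_sup sk) !mxrank_ker (eqP st).
Qed.

(** If every [phi] killed by [B ^+ k.+1] were orthogonal to the end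
    [v *m B ^+ k] of the chain, that end would be some [w *m B ^+ k.+1]; one
    more multiplication by [B] gives [w *m B ^+ k.+2 = 0], and then the end is
    zero because the kernels have stabilized. *)
Lemma chain_dual n (B : 'M[F]_n) k (v : 'rV[F]_n) :
    v *m B ^+ k.+1 = 0 -> v *m B ^+ k != 0 ->
    (forall w : 'rV[F]_n, w *m B ^+ k.+2 = 0 -> w *m B ^+ k.+1 = 0) ->
  exists2 phi : 'cV[F]_n, B ^+ k.+1 *m phi = 0 & (v *m B ^+ k *m phi) 0 0 = 1.
Proof.
move=> vk1 vk st; set u := v *m B ^+ k in vk *.
have : u *m cokermx (B ^+ k.+1) != 0.
  rewrite -submxE; apply: contra vk => /submxP[w uw].
  rewrite uw st // exprSr -mulmxE mulmxA -uw /u -mulmxA mulmxE -exprSr.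
  by rewrite vk1.
case/rV0Pn => j nz.
exists (((u *m cokermx (B ^+ k.+1)) 0 j)^-1 *: col j (cokermx (B ^+ k.+1))).
  by rewrite -scalemxAr -col_mul mulmx_coker col0 scaler0.
by rewrite -scalemxAr -col_mul !mxE mulVf //; move: nz; rewrite mxE.
Qed.

(** Pair the chain [v *m B ^+ i] with the columns [B ^+ j *m phi].  The entry
    at [(i, j)] depends on [i + j] only, is [1] for [i + j = k] and [0]
    beyond, so this Hankel matrix is invertible.  Therefore the chain is
    complementary to the vectors [K] that are orthogonal to all the columns,
    and these form an [A]-stable space. *)
Lemma split_jordan_chain n (A : 'M[F]_n) a : eigenvalue A a ->
  exists k (p : nat -> 'rV[F]_n) r (K : 'M[F]_(r, n)) (A' : 'M[F]_r),
   [/\ forall j, p j *m A = a *: p j + p j.+1, forall j, (k < j)%N -> p j = 0,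
       K *m A = A' *m K, row_free K
     & (k.+1 + r = n)%N /\ (1%:M <= \matrix_(j < k.+1) p j + K)%MS].
Proof.
move=> ev; set B := A - a%:M.
have : ~~ row_free B.
  by move: ev; rewrite /eigenvalue /eigenspace kermx_eq0.
case/kernel_chain_stabilizes => k [v [vk1 vk st]].
have [phi phik phi1] := chain_dual vk1 vk st.
pose P := \matrix_(j < k.+1) (v *m B ^+ j).
pose Q : 'M_(n, k.+1) := \matrix_(i, j) (B ^+ j *m phi) i 0.
have colQ j : col j Q = B ^+ j *m phi.
  by apply/colP => i; rewrite !mxE; apply: eq_bigr.
(* Listing the chain backwards makes the Hankel matrix lower triangular. *)
pose P' := \matrix_(j < k.+1) (v *m B ^+ (k - j)).
have PQ : P' *m Q \in unitmx.
  have Hij i j : (P' *m Q) i j = (v *m B ^+ (k - i + j) *m phi) 0 0.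
    rewrite exprD -mulmxE -!mulmxA -colQ -!col_mul [RHS]mxE /=.
    have -> : v *m (B ^+ (k - i) *m Q) = row i (P' *m Q).
      by rewrite row_mul rowK mulmxA.
    by rewrite [RHS]mxE.
  rewrite unitmxE det_trig.
    rewrite big1 ?unitr1 // => i _; rewrite Hij subnK ?phi1 //.
    by rewrite -ltnS.
  apply/is_trig_mxP => i j ij; rewrite Hij addnBAC; last by rewrite -ltnS.
  rewrite -[(k + j - i)%N](@subnK k.+1); last by have := ltn_ord i; lia.
  by rewrite exprD -mulmxE -!mulmxA phik !mulmx0 mxE.
exists k, (fun j => v *m B ^+ j), _, (row_base (kermx Q)).
have stab : (kermx Q *m A <= kermx Q)%MS.
  apply/sub_kermxP/matrixP => i j.
  suff : col j (kermx Q *m A *m Q) = 0 by move/colP/(_ i); rewrite !mxE.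
  rewrite -mulmxA !col_mul colQ.
  have -> : A = a%:M + B by rewrite /B addrC subrK.
  rewrite mulmxDl mulmxDr -!colQ mul_scalar_mx -scalemxAr -col_mul mulmx_ker.
  rewrite col0 scaler0 add0r colQ [B *m _]mulmxA (_ : B *m B ^+ j = B ^+ j.+1);
    last by rewrite exprS -mulmxE.
  have := ltn_ord j; rewrite leq_eqVlt => /orP[/eqP[->]|jk].
    by rewrite phik mulmx0.
  by rewrite -(colQ (Ordinal jk)) -col_mul mulmx_ker col0.
have /submxP[A' KA] : (row_base (kermx Q) *m A <= row_base (kermx Q))%MS.
  by rewrite (eqmxMr _ (eq_row_base _)) eq_row_base.
exists A'; split => // [j|j||].
- have -> : A = a%:M + B by rewrite /B addrC subrK.
  by rewrite mulmxDr mul_mx_scalar exprSr -mulmxE mulmxA.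
- by move=> kj; rewrite -(subnKC kj) exprD -mulmxE mulmxA vk1 mul0mx.
- exact: row_base_free.
split.
  have rQ : (\rank Q = k.+1)%N.
    apply/eqP; rewrite eqn_leq rank_leq_col.
    by rewrite -{1}(mxrank_unit PQ) mxrankM_maxr.
  by rewrite mxrank_ker rQ subnKC // -rQ rank_leq_row.
rewrite -/P.
pose E := Q *m invmx (P' *m Q) *m P'.
have -> : 1%:M = E + (1%:M - E) by rewrite addrC subrK.
rewrite addmx_sub_adds //.
  apply: submx_trans (submxMl _ _) _; apply/row_subP => i.
  have := row_sub (Ordinal (leq_subr i k : (k - i < k.+1)%N)) P.
  by rewrite !rowK.
rewrite eq_row_base; apply/sub_kermxP.
by rewrite mulmxBl mul1mx /E -!mulmxA mulVmx // mulmx1 subrr.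
Qed.

End JordanForm.

Lemma jordan_size_sum (F : fieldType) (s : seq (F * nat)) :
  jordan_size s = (\sum_(b <- s) b.2)%N.
Proof. by rewrite /jordan_size (big_nth (0, 0%N)) big_mkord. Qed.

(** The Jordan basis is a doubly indexed family of row vectors, extended by
    zero past the end of each block: this avoids matrices whose size depends
    on the block, and the relation [p i j *m A = a *: p i j + p i j.+1] then
    has no special case at the last row.  The last clause says that the rows
    span. *)
Lemma jordan_basis (F : closedFieldType) n (A : 'M[F]_n) :
  exists (s : seq (F * nat)) (p : nat -> nat -> 'rV[F]_n),
  [/\ forall b, b \in s -> (0 < b.2)%N /\ eigenvalue A b.1,
      jordan_size s = n,
      forall i j, p i j *m A = (block s i).1 *: p i j + p i j.+1,
      forall i j, ((block s i).2 <= j)%N -> p i j = 0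
    & forall x : 'cV[F]_n, (forall i j, p i j *m x = 0) -> x = 0].
Proof.
elim: n {-2}n (leqnn n) A => [|m IH] n.
  rewrite leqn0 => /eqP -> A; exists [::], (fun _ _ => 0); split => //.
  - by rewrite jordan_size_sum big_nil.
  - by move=> i j; rewrite mul0mx scaler0 addr0.
  - by move=> x _; apply: flatmx0.
move=> le_nm A; have [n0|n_gt0] := posnP n.
  by apply: IH; rewrite n0.
have [a ra] : exists a, root (char_poly A) a.
  by apply/closed_rootP; rewrite size_char_poly; case: n n_gt0 {IH le_nm A}.
have := ra; rewrite -eigenvalue_root_char => ev.
have [k [p [r [K [A' [pA p0 KA Kfree [krn full]]]]]]] := split_jordan_chain ev.
have [|s [q [evs sz qA q0 sep]]] := IH r _ A'; first by lia.
exists ((a, k.+1) :: s), (fun i => if i is i'.+1 then fun j => q i' j *m K else p).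
split.
- move=> b; rewrite inE => /orP[/eqP -> //|/evs[b2 /eigenvalueP[u uA' nzu]]].
  split=> //; apply/eigenvalueP; exists (u *m K).
    by rewrite -mulmxA KA mulmxA uA' scalemxAl.
  by rewrite mulmx_free_eq0.
- by rewrite jordan_size_sum big_cons -jordan_size_sum sz.
- case=> [|i] j /=; first exact: pA.
  by rewrite -mulmxA KA mulmxA qA mulmxDl scalemxAl.
- case=> [|i] j /= kj; first exact: p0.
  by rewrite q0 // mul0mx.
move=> x px; have Kx : K *m x = 0.
  by apply: sep => i j; rewrite mulmxA; apply: (px i.+1 j).
rewrite -[x]mul1mx; case/sub_addsmxP: full => -[D1 D2] ->.
rewrite mulmxDl -!mulmxA Kx mulmx0 addr0.
suff -> : (\matrix_(j < k.+1) p j) *m x = 0 by rewrite mulmx0.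
by apply/row_matrixP => j; rewrite row_mul rowK row0 (px 0%N j).
Qed.

Definition jordan_index (F : fieldType) (s : seq (F * nat)) : finType :=
  {i : 'I_(size s) & 'I_(block s i).2}.

Definition jordan_pos (F : fieldType) (s : seq (F * nat)) (i : 'I_(size s))
    (j : 'I_(block s i).2) : jordan_index s :=
  Tagged (fun i : 'I_(size s) => 'I_(block s i).2) j.

(** The number of rows is the dimension and the rows have no common zero, so
    the cokernel vanishes. *)
Lemma jordan_basis_unit (F : fieldType) (s : seq (F * nat))
    (p : nat -> nat -> 'rV[F]_(jordan_size s)) :
    (forall i j, ((block s i).2 <= j)%N -> p i j = 0) ->
    (forall x : 'cV[F]__, (forall i j, p i j *m x = 0) -> x = 0) ->
  \mxcol_(i < size s) (\matrix_(j < (block s i).2) p i j) \in unitmx.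
Proof.
move=> p0 sep; set P := mxcol _; rewrite -row_full_unit.
suff ck : cokermx P = 0.
  have := mxrank_coker P; rewrite ck mxrank0 => /esym/eqP.
  by rewrite subn_eq0 /row_full eqn_leq rank_leq_row => ->.
apply/matrixP => a b; rewrite [RHS]mxE.
suff : col b (cokermx P) = 0 by move/colP/(_ a); rewrite !mxE.
apply: sep => i j; have [ki|ik] := ltnP j (block s i).2; last first.
  by rewrite p0 // mul0mx.
have si : (i < size s)%N.
  by rewrite ltnNge; apply/negP => h; rewrite nth_default in ki.
have := mulmx_coker P => /(congr1 (fun B => submxcol B (Ordinal si))).
rewrite -submxcol_mul mxcolK submxcol0 => /(congr1 (row (Ordinal ki))).
by rewrite row_mul rowK row0 -col_mul => ->; rewrite col0.
Qed.

Lemma jordan_form_of_basis (F : fieldType) n (A : 'M[F]_n) (s : seq (F * nat))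
    (p : nat -> nat -> 'rV[F]_n) :
    (forall b, b \in s -> (0 < b.2)%N) -> jordan_size s = n ->
    (forall i j, p i j *m A = (block s i).1 *: p i j + p i j.+1) ->
    (forall i j, ((block s i).2 <= j)%N -> p i j = 0) ->
    (forall x : 'cV[F]_n, (forall i j, p i j *m x = 0) -> x = 0) ->
  jordan_form_of A s.
Proof.
move=> s0 e; case: n / e A p => A p pA p0 sep; split; first exact/allP.
exists erefl; rewrite castmx_id.
exists (\mxcol_(i < size s) (\matrix_(j < (block s i).2) p i j)).
  exact: jordan_basis_unit.
apply/simmxP; first exact: jordan_basis_unit.
rewrite mxcol_mul /jordan_mx mul_mxdiag_mxcol; apply: eq_mxcol => i.
apply/matrixP => j c; rewrite (@mul_jordan_block _ _ _ _ _ _ _ (fun l => p i l 0 c)).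
- have /rowP/(_ c) := pA i j; rewrite !mxE => <-.
  by apply: eq_bigr => l _; rewrite mxE.
- by move=> l; rewrite mxE.
- by rewrite p0 ?mxE.
Qed.

Lemma jordan_basis_dual (F : fieldType) n (s : seq (F * nat))
    (p : nat -> nat -> 'rV[F]_n) : jordan_size s = n ->
    (forall i j, ((block s i).2 <= j)%N -> p i j = 0) ->
    (forall x : 'cV[F]_n, (forall i j, p i j *m x = 0) -> x = 0) ->
  exists g : jordan_index s -> 'cV[F]_n, forall t u : jordan_index s,
    (p (tag t) (tagged t) *m g u) 0 0 = (t == u)%:R.
Proof.
move=> e; case: n / e p => p p0 sep.
set P := \mxcol_(i < size s) (\matrix_(j < (block s i).2) p i j).
have uP : P \in unitmx by exact: jordan_basis_unit.
exists (fun u : jordan_index s => invmx P *m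
  \mxcol_(i < size s) (\col_(j < (block s i).2) (jordan_pos j == u)%:R)) => t u.
set x := mxcol _.
have : submxcol (P *m (invmx P *m x)) (tag t) = submxcol x (tag t).
  by rewrite mulKVmx.
rewrite -submxcol_mul !mxcolK => /colP/(_ (tagged t)); rewrite mxE [RHS]mxE.
case: t => i j /= <-; rewrite !mxE; apply: eq_bigr => l _.
by rewrite !mxE.
Qed.

(** * Orbits under a Jordan block and its inverse *)

Lemma leq_expn2r m n e : (m <= n)%N -> (m ^ e <= n ^ e)%N.
Proof. by case: e => [|e] mn; rewrite ?expn0 // leq_exp2r. Qed.

Lemma bin_le_expn m l : ('C(m, l) <= m.+1 ^ l)%N.
Proof.
elim: m l => [|m IH] [|l]; rewrite ?bin0 ?expn0 ?bin0n // binS.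
have := IH l; have := IH l.+1; rewrite (expnS _ l) (expnS _ l) => h1 h2.
have h3 : (m.+1 ^ l <= m.+2 ^ l)%N by exact: leq_expn2r.
nia.
Qed.

Lemma expn_le_bin m l : (l <= m)%N ->
  (m.+1 ^ l <= l.+1 ^ l * l`! * 'C(m, l))%N.
Proof.
move=> lm; rewrite -mulnA [(l`! * _)%N]mulnC bin_ffact.
have h : ((m.+1 - l) ^ l <= m ^_ l)%N.
  elim: l m {lm} => [|l IH] m //; case: m => [|m]; first by rewrite exp0n.
  rewrite subSS expnS ffactSS; apply: leq_mul (IH m); lia.
apply: leq_trans (leq_mul (leqnn _) h).
by rewrite -expnMn; apply: leq_expn2r; nia.
Qed.

(** The numbers [y m j] are the coordinates in one Jordan block, of size [k] and
    eigenvalue [a], of the vector at time [m] of an orbit. *)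
Section OrbitCoefficients.
Variables (F : fieldType) (a : F) (k : nat) (y : nat -> nat -> F).
Hypothesis a0 : a != 0.
Hypothesis yk : forall m j, (k <= j)%N -> y m j = 0.

Lemma sum_shift (f z : nat -> F) : z k = 0 ->
  \sum_(l < k) f l * z l = f 0%N * z 0%N + \sum_(l < k) f l.+1 * z l.+1.
Proof.
move=> zk; rewrite -(big_ord_recl _ (fun l : 'I__ => f l * z l)) big_ord_recr.
by rewrite /= zk mulr0 addr0.
Qed.

(** The expansion of [(a + N) ^ m], with [N] the nilpotent shift. *)
Lemma forward_orbit : (forall m j, y m.+1 j = a * y m j + y m j.+1) ->
  forall m j, y m j =
    a ^+ m * \sum_(l < k) ('C(m, l)%:R * a ^- l) * y 0%N (j + l)%N.
Proof.
move=> yS; pose z j l := a ^- l * y 0%N (j + l)%N.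
suff h m j : y m j = a ^+ m * \sum_(l < k) 'C(m, l)%:R * z j l.
  by move=> m j; rewrite h; congr (_ * _); apply: eq_bigr => l _; rewrite mulrA.
have zk i : z i k = 0 by rewrite /z yk ?mulr0 // leq_addl.
have zS i l : z i.+1 l = a * z i l.+1.
  by rewrite /z exprS invfM addSnnS !mulrA divff // mul1r.
elim: m j => [|m IH] j.
  rewrite (@sum_shift (fun l => 'C(0, l)%:R)) // big1 => [|l _].
    by rewrite /z addn0 expr0 invr1 !mul1r addr0.
  by rewrite bin0n mul0r.
rewrite yS !IH exprS.
rewrite (@sum_shift (fun l => 'C(m.+1, l)%:R)) //.
rewrite (@sum_shift (fun l => 'C(m, l)%:R) (z j)) //.
under [X in _ + _ * X = _]eq_bigr => l _ do rewrite zS mulrCA.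
rewrite -mulr_sumr !bin0.
under [X in _ = _ * (_ + X)]eq_bigr => l _ do rewrite binS natrD mulrDl.
by rewrite big_split /=; ring.
Qed.

(** The expansion of [(a + N) ^ - m].  In the binomial coefficient the
    truncated predecessor matters at [m = 0] only: it makes the coefficient
    [1] for [l = 0] and [0] for [l > 0], as required there. *)
Lemma backward_orbit : (forall m j, a * y m.+1 j + y m.+1 j.+1 = y m j) ->
  forall m j, y m j = a ^- m *
    \sum_(l < k) ((-1) ^+ l * 'C((m + l).-1, l)%:R * a ^- l) * y 0%N (j + l)%N.
Proof.
move=> yS; pose z j l := a ^- l * y 0%N (j + l)%N.
pose b m l : F := (-1) ^+ l * 'C((m + l).-1, l)%:R.
suff h m j : y m j = a ^- m * \sum_(l < k) b m l * z j l.
  by move=> m j; rewrite h; congr (_ * _); apply: eq_bigr => l _; rewrite mulrA.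
have zk i : z i k = 0 by rewrite /z yk ?mulr0 // leq_addl.
have zS i l : z i.+1 l = a * z i l.+1.
  by rewrite /z exprS invfM addSnnS !mulrA divff // mul1r.
have b0 i : b i 0%N = 1 by rewrite /b bin0 mulr1.
have bS i l : b i.+1 l.+1 = b i l.+1 - b i.+1 l.
  by rewrite /b !addnS !addSn /= binS natrD exprS; ring.
elim: m j => [|m IH] j.
  rewrite (@sum_shift (b 0%N)) // big1 => [|l _].
    by rewrite b0 /z addn0 expr0 invr1 !mul1r addr0.
  by rewrite /b add0n /= bin_small // mulr0 mul0r.
(* The recurrence determines [y m.+1 j] from [y m.+1 j.+1]: go down from the
   end of the block. *)
have [d jd] : exists d, (k <= j + d)%N by exists k; rewrite leq_addl.
elim: d j jd => [|d IHd] j jd.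
  rewrite yk ?big1 ?mulr0 // => [l _|]; last by rewrite -(addn0 j).
  by rewrite /z yk ?mulr0 //; lia.
apply: (mulfI a0); rewrite -[LHS](addrK (y m.+1 j.+1)) yS IH IHd; last by lia.
rewrite (@sum_shift (b m)) // (@sum_shift (b m.+1) (z j)) //.
under [X in _ - _ * X = _]eq_bigr => l _ do rewrite zS mulrCA.
rewrite -mulr_sumr !b0.
under [X in _ = _ * (_ * (_ + X))]eq_bigr => l _ do rewrite bS mulrBl.
rewrite big_split /= sumrN.
have -> : a ^- m = a * a ^- m.+1 by rewrite exprS invfM mulrA divff ?mul1r.
by ring.
Qed.

End OrbitCoefficients.

(** * Comparison of growth rates *)

Section Growth.
Variable R : realType.
Implicit Types r s : R.

Definition growth r k m : R := r ^+ m * m.+1%:R ^+ k.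

Definition growth_le r k s l := (r < s) || (r == s) && (k <= l)%N.

Lemma growth_ge0 r k m : 0 < r -> 0 <= growth r k m.
Proof. by move=> r0; rewrite mulr_ge0 ?exprn_ge0 ?ler0n // ltW. Qed.

Lemma growthSr r k m : growth r k.+1 m = growth r k m * m.+1%:R.
Proof. by rewrite /growth exprSr mulrA. Qed.

(** Bernoulli: [(1 + h) ^ m >= 1 + m h] for [1 + h = 1 / s]. *)
Lemma linear_exp_bounded s : 0 < s < 1 ->
  exists2 c : R, 0 <= c & forall m, m.+1%:R * s ^+ m <= c.
Proof.
case/andP=> s0 s1; pose h := s^-1 - 1.
have h0 : 0 < h by rewrite subr_gt0 invf_gt1.
have hB m : 1 + m%:R * h <= (1 + h) ^+ m.
  elim: m => [|m IH]; first by rewrite mul0r addr0.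
  rewrite exprSr; apply: le_trans (ler_wpM2r _ IH); last by lra.
  have := ler0n R m; rewrite -natr1; nra.
exists (1 + h^-1) => [|m]; first by rewrite addr_ge0 ?invr_ge0 // ltW.
rewrite -ler_pdivlMr ?exprn_gt0 // -exprVn.
have -> : s^-1 = 1 + h by rewrite /h; ring.
apply: le_trans (ler_wpM2l _ (hB m)); last by rewrite addr_ge0 ?invr_ge0 // ltW.
have -> : (1 + h^-1) * (1 + m%:R * h) = m.+1%:R + (h^-1 + m%:R * h).
  by rewrite -natr1; field; rewrite gt_eqF.
by rewrite lerDl addr_ge0 ?mulr_ge0 ?invr_ge0 // ltW.
Qed.

Lemma poly_exp_bounded k s : 0 < s < 1 ->
  exists2 c : R, 0 <= c & forall m, m.+1%:R ^+ k * s ^+ m <= c.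
Proof.
elim: k s => [|k IH] s s01.
  exists 1 => // m; rewrite mul1r exprn_ile1 //; lra.
have /andP[s0 s1] := s01.
(* Share the exponential between one linear factor and the remaining [k]. *)
pose t := Num.sqrt s; have t2 : s = t * t by rewrite -expr2 sqr_sqrtr // ltW.
have t01 : 0 < t < 1 by rewrite sqrtr_gt0 s0 -sqrtr1 ltr_sqrt.
have [c c0 hc] := IH t t01; have [d d0 hd] := linear_exp_bounded t01.
exists (c * d) => [|m]; first exact: mulr_ge0.
have -> : m.+1%:R ^+ k.+1 * s ^+ m = (m.+1%:R ^+ k * t ^+ m) * (m.+1%:R * t ^+ m).
  by rewrite t2 exprMn exprSr; ring.
have /andP[t0 _] := t01.
by apply: ler_pM; rewrite ?mulr_ge0 ?exprn_ge0 // ltW.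
Qed.

(** An exponential with a larger base absorbs every power of [m + 1]. *)
Lemma growth_leP r k s l : 0 < r -> 0 < s -> growth_le r k s l ->
  exists2 c : R, 0 <= c & forall m, growth r k m <= c * growth s l m.
Proof.
move=> r0 s0 /orP[rs|/andP[/eqP <- kl]]; last first.
  exists 1 => // m; rewrite mul1r ler_wpM2l ?exprn_ge0 ?(ltW r0) //.
  by apply: ler_weXn2l => //; rewrite ler1n.
have [|c c0 hc] := @poly_exp_bounded k (r / s).
  by rewrite divr_gt0 // ltr_pdivrMr // mul1r.
exists c => // m; have := hc m; rewrite exprMn exprVn mulrA ler_pdivrMr ?exprn_gt0 //.
rewrite /growth mulrC => /le_trans; apply; rewrite ler_wpM2l //.
by rewrite ler_peMr ?exprn_ge0 ?(ltW s0) // exprn_ege1 // ler1n.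
Qed.

End Growth.

(** * The modulus of complex numbers *)

Section ComplexNorm.
Variable R : realType.
Local Notation C := R[i].
Implicit Types z w : C.

Lemma normc_ge0 z : 0 <= normc z.
Proof. by case: z => a b; apply: sqrtr_ge0. Qed.

Lemma normcD z w : normc (z + w) <= normc z + normc w.
Proof. exact: le_normcD. Qed.

Lemma normc_eq0 z : (normc z == 0) = (z == 0).
Proof.
apply/eqP/eqP => [/ComplexField.Normc.eq0_normc //|->].
exact: ComplexField.Normc.normc0.
Qed.

Lemma normc_gt0 z : (0 < normc z) = (z != 0).
Proof. by rewrite lt_def normc_eq0 normc_ge0 andbT. Qed.

Lemma normcX z m : normc (z ^+ m) = normc z ^+ m.
Proof.
elim: m => [|m IH]; first by rewrite !expr0 ComplexField.Normc.normc1.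
by rewrite !exprS ComplexField.Normc.normcM IH.
Qed.

Lemma normc_nat m : normc (m%:R : C) = m%:R.
Proof.
by rewrite normcMn ComplexField.Normc.normc1.
Qed.

Lemma normc_sum (I : Type) (r : seq I) (P : pred I) (f : I -> C) :
  normc (\sum_(i <- r | P i) f i) <= \sum_(i <- r | P i) normc (f i).
Proof.
elim/big_ind2: _ => // [|x1 x2 y1 y2 h1 h2]; first by rewrite ComplexField.Normc.normc0.
by apply: le_trans (normcD _ _) _; rewrite lerD.
Qed.

Lemma Re_le_normc z : `|complex.Re z| <= normc z.
Proof.
case: z => a b /=; rewrite -sqrtr_sqr ler_sqrt ?addr_ge0 ?sqr_ge0 //.
by rewrite lerDl sqr_ge0.
Qed.

Lemma Im_le_normc z : `|complex.Im z| <= normc z.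
Proof.
case: z => a b /=; rewrite -sqrtr_sqr ler_sqrt ?addr_ge0 ?sqr_ge0 //.
by rewrite lerDr sqr_ge0.
Qed.

Lemma normc_le_ReIm z : normc z <= `|complex.Re z| + `|complex.Im z|.
Proof.
case: z => a b /=; rewrite -[leRHS]ger0_norm ?addr_ge0 // -sqrtr_sqr.
rewrite ler_sqrt ?sqr_ge0 // sqrrD !real_normK ?num_real //.
by rewrite -addrA lerD2l lerDr mulrn_wge0 // mulr_ge0.
Qed.

Definition box n (v : 'cV[C]_n) (D : R) := forall i, normc (v i 0) <= D.

End ComplexNorm.

(** * Domination by a sequence *)

Section Dominated.
Variables (R : realType) (gam : nat -> R).
Hypothesis gam0 : forall m, 0 <= gam m.

Definition dominated (f : nat -> R) := exists2 c, 0 <= c & forall m, f m <= c * gam m.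

Lemma dominated_le f g : (forall m, f m <= g m) -> dominated g -> dominated f.
Proof. by move=> fg [c c0 h]; exists c => // m; apply: le_trans (h m). Qed.

Lemma dominated0 : dominated (fun=> 0).
Proof. by exists 0 => // m; rewrite mul0r. Qed.

Lemma dominatedZ a f : 0 <= a -> dominated f -> dominated (fun m => a * f m).
Proof.
move=> a0 [c c0 h]; exists (a * c) => [|m]; first exact: mulr_ge0.
by rewrite -mulrA ler_wpM2l.
Qed.

Lemma dominatedD f g : dominated f -> dominated g -> dominated (fun m => f m + g m).
Proof.
move=> [c c0 h] [d d0 h']; exists (c + d) => [|m]; first exact: addr_ge0.
by rewrite mulrDl lerD.
Qed.

Lemma dominated_sum (I : Type) (r : seq I) (P : pred I) (f : I -> nat -> R) :
  (forall i, P i -> dominated (f i)) -> dominated (fun m => \sum_(i <- r | P i) f i m).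
Proof.
move=> h; elim: r => [|i r IH].
  by apply: dominated_le dominated0 => m; rewrite big_nil.
have [Pi|nPi] := boolP (P i).
  by apply: dominated_le (dominatedD (h i Pi) IH) => m; rewrite big_cons Pi.
by apply: dominated_le IH => m; rewrite big_cons (negPf nPi).
Qed.

Lemma dominated_fin (T : finType) (f : T -> nat -> R) :
    (forall t, dominated (f t)) ->
  exists2 c, 0 <= c & forall t m, f t m <= c * gam m.
Proof.
move=> h; have [c hc] := boolp.choice (fun t =>
  let: ex_intro2 c c0 hc := h t in
  ex_intro (fun c => 0 <= c /\ forall m, f t m <= c * gam m) c (conj c0 hc)).
exists (\sum_t c t) => [|t m].
  by apply: sumr_ge0 => t _; case: (hc t).
apply: le_trans (proj2 (hc t) m) _; rewrite ler_wpM2r //.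
by rewrite (bigD1 t) //= lerDl sumr_ge0 // => u _; case: (hc u).
Qed.

End Dominated.

(** * Growth of orbits in Jordan coordinates *)

Section JordanDynamics.
Variable R : realType.
Local Notation C := R[i].

(** A sequence of matrices [dyn] that acts in Jordan coordinates as the powers
    of a matrix or of its inverse do: [mult i] is the eigenvalue or its inverse,
    and [coef i m l], the coefficient of the shift by [l] in the block [i] at
    time [m], is of exact order [m ^ l].  The growth of orbits depends on these
    data only. *)
Record jordan_dynamics n := JordanDynamics {
  dyn : nat -> 'M[C]_n;
  blocks : seq (C * nat);
  covec : nat -> nat -> 'rV[C]_n;
  dual : jordan_index blocks -> 'cV[C]_n;
  mult : nat -> C;
  coef : nat -> nat -> nat -> C;
  dyn0 : dyn 0 = 1%:M;
  covec_out : forall i j, ((block blocks i).2 <= j)%N -> covec i j = 0;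
  covec_sep : forall v : 'cV[C]_n, (forall i j, covec i j *m v = 0) -> v = 0;
  covec_dual : forall t u : jordan_index blocks,
    (covec (tag t) (tagged t) *m dual u) 0 0 = (t == u)%:R;
  dynE : forall m (v : 'cV[C]_n) i j, (covec i j *m (dyn m *m v)) 0 0 = mult i ^+ m *
    \sum_(l < (block blocks i).2) coef i m l * (covec i (j + l) *m v) 0 0;
  mult_neq0 : forall i, (i < size blocks)%N -> mult i != 0;
  coef_up : forall i l, exists2 c : R, 0 <= c &
    forall m, normc (coef i m l) <= c * m.+1%:R ^+ l;
  coef_low : forall i l, (i < size blocks)%N -> exists2 c : R, 0 <= c &
    forall m, (l <= m)%N -> m.+1%:R ^+ l <= c * normc (coef i m l)
}.

Variables (n : nat) (X : jordan_dynamics n).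
Implicit Types (v w : 'cV[C]_n) (t u : jordan_index (blocks X)).

Definition jcoord v t : C := (covec X (tag t) (tagged t) *m v) 0 0.

Lemma jcoordB v w t : jcoord (v - w) t = jcoord v t - jcoord w t.
Proof. by rewrite /jcoord mulmxBr !mxE. Qed.

Lemma jcoord_sum (a : jordan_index (blocks X) -> C) t :
  jcoord (\sum_u a u *: dual u) t = a t.
Proof.
rewrite /jcoord mulmx_sumr summxE (bigD1 t) //= -scalemxAr mxE.
rewrite (covec_dual t t) eqxx mulr1 big1 ?addr0 // => u ut.
by rewrite -scalemxAr mxE (covec_dual t u) eq_sym (negPf ut) mulr0.
Qed.

Lemma jcoord_expansion v : v = \sum_t jcoord v t *: dual t.
Proof.
apply/eqP; rewrite -subr_eq0; apply/eqP/(@covec_sep _ X) => i j.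
have [kj|jk] := leqP (block (blocks X) i).2 j; first by rewrite covec_out ?mul0mx.
have si : (i < size (blocks X))%N.
  by rewrite ltnNge; apply/negP => h; rewrite nth_default in jk.
apply/matrixP => a b; rewrite !ord1 [RHS]mxE.
rewrite -[LHS]/(jcoord _ (@jordan_pos _ (blocks X) (Ordinal si) (Ordinal jk))).
by rewrite jcoordB jcoord_sum subrr.
Qed.

Lemma jcoord_box : exists2 c : R, 0 <= c &
  forall v D, 0 <= D -> box v D -> forall t, normc (jcoord v t) <= c * D.
Proof.
pose f t := \sum_a normc (covec X (tag t) (tagged t) 0 a).
have f0 t : 0 <= f t by apply: sumr_ge0 => a _; apply: normc_ge0.
exists (\sum_t f t) => [|v D D0 vD t]; first by apply: sumr_ge0.
apply: (@le_trans _ _ (f t * D)).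
  rewrite /jcoord mxE; apply: le_trans (normc_sum _ _ _) _.
  rewrite /f mulr_suml; apply: ler_sum => a _.
  by rewrite ComplexField.Normc.normcM ler_wpM2l ?normc_ge0.
by rewrite ler_wpM2r // (bigD1 t) //= lerDl sumr_ge0.
Qed.

Lemma box_jcoord : exists2 c : R, 0 <= c &
  forall v D, 0 <= D -> (forall t, normc (jcoord v t) <= D) -> box v (c * D).
Proof.
pose f a := \sum_(t : jordan_index (blocks X)) normc (dual t a 0).
have f0 a : 0 <= f a by apply: sumr_ge0 => t _; apply: normc_ge0.
exists (\sum_a f a) => [|v D D0 vD a]; first by apply: sumr_ge0.
apply: (@le_trans _ _ (f a * D)).
  rewrite [in leLHS](jcoord_expansion v) summxE; apply: le_trans (normc_sum _ _ _) _.
  rewrite /f mulr_suml; apply: ler_sum => t _.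
  by rewrite mxE ComplexField.Normc.normcM mulrC ler_wpM2l ?normc_ge0.
by rewrite ler_wpM2r // (bigD1 a) //= lerDl sumr_ge0.
Qed.

(** [rate r k] has order [r ^ m (m + 1) ^ (k - 1)].  The shift of the exponent
    makes room for [k = 0], which is below the growth of every nonzero vector
    in the blocks of modulus [r]. *)
Definition rate (r : R) k m : R := growth r k m / m.+1%:R.

Lemma rate_ge0 r k m : 0 < r -> 0 <= rate r k m.
Proof. by move=> r0; rewrite divr_ge0 ?growth_ge0. Qed.

Lemma rateS r k m : rate r k.+1 m = growth r k m.
Proof. by rewrite /rate growthSr mulfK // pnatr_eq0. Qed.

Lemma dominated_rate r k s l : 0 < r -> 0 < s -> growth_le r k s l ->
  dominated (rate s l) (rate r k).
Proof.
move=> r0 s0 /(growth_leP r0 s0)[c c0 h]; exists c => // m.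
by rewrite /rate mulrA ler_wpM2r ?invr_ge0.
Qed.

(** A vector supported at position [tagged t], and nowhere higher, of the block
    [tag t] has growth [rate |mult| (tagged t).+1]; the condition is that this
    does not exceed [rate r k]. *)
Definition in_flag (r : R) k t := growth_le (normc (mult X (tag t))) (tagged t).+1 r k.

Definition slow r k v := exists2 c : R, 0 <= c &
  forall m, box (dyn X m *m v) (c * rate r k m).

(** Each coordinate at time [m] is a finite sum of terms of order
    [|mu| ^ m m ^ l] times the coordinate [j + l] of [v]; when that coordinate
    is nonzero, [rate |mu| l.+1] is at most [rate |mu| (j + l).+1], hence at
    most [rate r k]. *)
Lemma slow_of_flag r k v : 0 < r ->
  (forall t, ~~ in_flag r k t -> jcoord v t = 0) -> slow r k v.
Proof.
move=> r0 v0; have rg m := rate_ge0 k m r0.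
have [c2 c20 hc2] := box_jcoord.
suff /(dominated_fin rg)[c c0 hc] : forall t,
    dominated (rate r k) (fun m => normc (jcoord (dyn X m *m v) t)).
  exists (c2 * c) => [|m]; first exact: mulr_ge0.
  by rewrite -mulrA; apply: hc2 => [|t]; [exact: mulr_ge0 | exact: hc].
move=> [i j]; set mu := normc (mult X i).
have mu0 : 0 < mu by rewrite normc_gt0 mult_neq0.
pose f l m := mu ^+ m * (normc (coef X i m l) * normc ((covec X i (j + l) *m v) 0 0)).
apply: (@dominated_le _ _ _ (fun m => \sum_(l < (block (blocks X) i).2) f l m)).
  move=> m; rewrite /jcoord dynE /= ComplexField.Normc.normcM normcX -/mu /f -mulr_sumr.
  rewrite ler_wpM2l ?exprn_ge0 ?normc_ge0 //.
  apply: le_trans (normc_sum _ _ _) _; apply: ler_sum => l _.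
  by rewrite ComplexField.Normc.normcM.
apply: dominated_sum => // l _; rewrite /f.
have [->|x0] := eqVneq ((covec X i (j + l) *m v) 0 0) 0.
  by apply: dominated_le (dominated0 _) => m; rewrite ComplexField.Normc.normc0 !mulr0.
have jl : (j + l < (block (blocks X) i).2)%N.
  by rewrite ltnNge; apply: contra x0 => h; rewrite covec_out // mul0mx mxE.
pose t := jordan_pos (Ordinal jl).
have : in_flag r k t by apply: contraNT x0 => /v0; rewrite /jcoord /= => ->.
rewrite /in_flag /= -/mu => fl.
have : growth_le mu l.+1 r k.
  case/orP: fl => [|/andP[mr lk]]; rewrite /growth_le; first by move->.
  by rewrite mr (leq_trans _ lk) ?orbT // ltnS leq_addl.
move=> /(dominated_rate mu0 r0).
have [c c0 hc] := coef_up X i l.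
move=> /(dominatedZ (mulr_ge0 c0 (normc_ge0 ((covec X i (j + l) *m v) 0 0)))).
apply: dominated_le => m; rewrite rateS /growth [leRHS]mulrC -mulrA ler_wpM2l //.
  by rewrite exprn_ge0 // ltW.
by rewrite mulrA ler_wpM2r ?normc_ge0 // mulrC.
Qed.

(** Let [d] be the topmost nonzero position of [v] in a block where some
    coordinate outside the flag is nonzero.  The coordinate at position [0] of
    the orbit contains the term [l = d], of order [|mu| ^ m m ^ d].  The other
    terms are smaller by a factor [m + 1] at least, and so is the whole
    coordinate when [v] is slow, which is absurd for large [m]. *)
Lemma flag_of_slow r k v t : 0 < r -> slow r k v -> ~~ in_flag r k t -> jcoord v t = 0.
Proof.
case: t => i j r0 [c c0 sv] nfl; apply/eqP; apply/negPn/negP => xj.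
set mu := normc (mult X i) in nfl.
have mu0 : 0 < mu by rewrite normc_gt0 mult_neq0.
pose x l : C := (covec X i l *m v) 0 0.
have xout l : ((block (blocks X) i).2 <= l)%N -> x l = 0.
  by move=> h; rewrite /x covec_out // mul0mx mxE.
have exd : exists l, x l != 0 by exists j.
have bd l : x l != 0 -> (l <= (block (blocks X) i).2)%N.
  by apply: contraR; rewrite -ltnNge => /ltnW/xout ->.
case: (ex_maxnP exd bd) => d xd dmax; have jd := dmax j xj.
have dk : (d < (block (blocks X) i).2)%N.
  by rewrite ltnNge; apply: contra xd => /xout ->.
have rmu : growth_le r k mu d.
  move: nfl; rewrite /in_flag /growth_le -/mu /= negb_or negb_and -leNgt -leqNgt.
  by case: ltgtP => //= _ kj; exact: leq_trans kj jd.
have gg m : 0 <= rate mu d m by exact: rate_ge0.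
pose t0 := jordan_pos (Ordinal (leq_ltn_trans (leq0n d) dk)).
pose f l m := mu ^+ m * (normc (coef X i m l) * normc (x l)).
have yE m : jcoord (dyn X m *m v) t0 =
    mult X i ^+ m * \sum_(l < (block (blocks X) i).2) coef X i m l * x l.
  by rewrite /jcoord dynE.
have : dominated (rate mu d) (f d).
  apply: (@dominated_le _ _ _ (fun m => normc (jcoord (dyn X m *m v) t0)
     + \sum_(l < (block (blocks X) i).2 | l != d :> nat) f l m)) => [m|].
    rewrite yE (bigD1 (Ordinal dk)) //= mulrDr.
    set a := _ * (_ * x d); set b := \sum_(l < _ | _) _.
    have -> : f d m = normc ((a + mult X i ^+ m * b) - mult X i ^+ m * b).
      by rewrite addrK !ComplexField.Normc.normcM normcX.
    apply: le_trans (normcD _ _) _; rewrite normcN lerD2l.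
    rewrite ComplexField.Normc.normcM normcX -mulr_sumr ler_wpM2l ?exprn_ge0 ?normc_ge0 //.
    apply: le_trans (normc_sum _ _ _) _.
    by apply: ler_sum => l _; rewrite ComplexField.Normc.normcM.
  apply: dominatedD.
    have [c1 c10 hc1] := jcoord_box.
    have := dominatedZ (mulr_ge0 c10 c0) (dominated_rate r0 mu0 rmu).
    apply: dominated_le => m; rewrite -mulrA; apply: hc1 => //.
    by rewrite mulr_ge0 // rate_ge0.
  apply: dominated_sum => // l ld; have [lld|dl] := ltnP l d; last first.
    have -> : f l = fun=> 0; last exact: dominated0.
    apply/funext => m; rewrite /f; have [->|xl] := eqVneq (x l) 0.
      by rewrite ComplexField.Normc.normc0 !mulr0.
    by have := dmax _ xl; lia.
  have [c1 c10 hc1] := coef_up X i l.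
  have : growth_le mu l.+1 mu d by rewrite /growth_le eqxx lld orbT.
  move=> /(dominated_rate mu0 mu0).
  move=> /(dominatedZ (mulr_ge0 c10 (normc_ge0 (x l)))).
  apply: dominated_le => m; rewrite rateS /growth [leRHS]mulrC -mulrA ler_wpM2l //.
    by rewrite exprn_ge0 // ltW.
  by rewrite mulrA ler_wpM2r ?normc_ge0 // mulrC.
case=> c1 c10 hc1; have [c2 c20 hc2] := @coef_low _ X i d (ltn_ord i).
have nx : 0 < normc (x d) by rewrite normc_gt0.
have key m : (d <= m)%N -> m.+1%:R * normc (x d) <= c2 * c1.
  move=> dm; have M0 : 0 < m.+1%:R :> R by rewrite ltr0n.
  have h2 := hc2 m dm.
  have h1 : normc (coef X i m d) * normc (x d) * m.+1%:R <= c1 * m.+1%:R ^+ d.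
    have h := hc1 m; rewrite /f /rate /growth in h.
    rewrite [leRHS]mulrA ler_pdivlMr // [leRHS]mulrCA -(mulrA (mu ^+ m)) in h.
    by rewrite ler_pM2l ?exprn_gt0 in h.
  rewrite -(ler_pM2l (exprn_gt0 d M0)).
  have := ler_wpM2r (ltW (mulr_gt0 M0 nx)) h2 => /le_trans; apply.
  have := ler_wpM2l c20 h1; congr (_ <= _); last by rewrite mulrA mulrC.
  by rewrite [m.+1%:R * _]mulrC !mulrA.
pose m := maxn d (Num.truncn (c2 * c1 / normc (x d))).
have := key m (leq_maxl _ _); apply/negP; rewrite -ltNge -ltr_pdivrMr //.
apply: lt_le_trans (truncnS_gt _) _.
by rewrite ler_nat ltnS leq_maxr.
Qed.

End JordanDynamics.

(** * Coarse maps and dimension *)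

(** Quasi-isometric embeddings do not lower dimension.  The grid of [N + 1]
    points in each direction, of mesh [L], has [(N + 1) ^ #|T1|] points.
    Images of distinct points do not share a unit cell, and the images lie in
    a box of side of order [N], which has at most [(c (N + 1)) ^ #|T2|] cells
    for a constant [c].  For [#|T1| > #|T2|] this fails at
    [N = c ^ #|T2|]. *)
Lemma coarse_card (R : realType) (T1 T2 : finType) (h : (T1 -> R) -> T2 -> R)
    (K1 C1 K2 C2 : R) : 0 <= K1 -> 0 <= C1 -> 0 <= K2 -> 0 <= C2 ->
    (forall x y D, 0 <= D -> (forall i, `|x i - y i| <= D) ->
       forall j, `|h x j - h y j| <= K1 * D + C1) ->
    (forall x y D, 0 <= D -> (forall j, `|h x j - h y j| <= D) ->
       forall i, `|x i - y i| <= K2 * D + C2) ->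
  (#|T1| <= #|T2|)%N.
Proof.
move=> K10 C10 K20 C20 up low.
(* Points whose images differ by at most [1] are at distance at most
   [K2 + C2], hence the mesh. *)
pose L : R := K2 + C2 + 1; have L0 : 0 < L by rewrite /L; lra.
pose W := (Num.truncn (K1 * L + C1)).+1.
have WL : K1 * L + C1 < W%:R by exact: truncnS_gt.
pose c := (2 * W + 1)%N.
have count N : (N.+1 ^ #|T1| <= (c * N.+1) ^ #|T2|)%N.
  pose gr (g : {ffun T1 -> 'I_N.+1}) (i : T1) : R := L * (g i)%:R.
  pose x0 (i : T1) : R := 0.
  pose B := (2 * W * N.+1)%N.
  pose cl g j := h (gr g) j - h x0 j + (W * N.+1)%:R.
  have hb g j : 0 <= cl g j < B.+1%:R.
    have : `|h (gr g) j - h x0 j| <= K1 * (L * N%:R) + C1.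
      apply: up => [|i]; first by rewrite mulr_ge0 // ltW.
      rewrite /gr /x0 subr0 normrM gtr0_norm // ger0_norm //.
      by rewrite ler_pM2l // ler_nat -ltnS ltn_ord.
    have : K1 * (L * N%:R) + C1 <= W%:R * N.+1%:R.
      apply: le_trans (ler_wpM2r _ (ltW WL)) => //.
      have := mulr_ge0 C10 (ler0n R N); have := mulr_ge0 K10 (ltW L0).
      by rewrite -natr1; lra.
    rewrite ler_norml => h1 /andP[h2 h3]; rewrite /cl /B -natr1 !natrM.
    by apply/andP; split; lra.
  pose cell g : {ffun T2 -> 'I_B.+1} := [ffun j => inord (Num.truncn (cl g j))].
  have cell_inj : injective cell.
    move=> g g' /ffunP eqc; apply/ffunP => i; apply/eqP/negPn/negP => gi.
    have : `|gr g i - gr g' i| <= K2 * 1 + C2.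
      apply: low => // j; have := eqc j; rewrite !ffunE => /(congr1 val) /=.
      have [/andP[l1 u1] /andP[l2 u2]] := (hb g j, hb g' j).
      rewrite !inordK ?truncn_lt_nat // => e.
      have := truncn_itv l1; have := truncn_itv l2; rewrite e -natr1.
      by rewrite /cl => /andP[a1 a2] /andP[a3 a4]; rewrite ler_norml; lra.
    apply/negP; rewrite -ltNge mulr1.
    apply: (@lt_le_trans _ _ L); first by rewrite /L ltrDl.
    rewrite /gr -mulrBr normrM gtr0_norm // ler_peMr ?(ltW L0) //.
    move: gi; rewrite -val_eqE /=; move: (val (g i)) (val (g' i)) => a b /= ab.
    case: (ltngtP a b) ab => // ab _.
      by rewrite distrC -natrB ?(ltnW ab) // normr_nat ler1n subn_gt0.
    by rewrite -natrB ?(ltnW ab) // normr_nat ler1n subn_gt0.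
  have := leq_card _ cell_inj; rewrite !card_ffun !card_ord => /leq_trans; apply.
  by apply: leq_expn2r; rewrite /B /c; nia.
rewrite leqNgt; apply/negP => lt21.
have := count (c ^ #|T2|)%N; set N := (c ^ #|T2|)%N.
have : (N.+1 ^ #|T2|.+1 <= N.+1 ^ #|T1|)%N by rewrite leq_pexp2l.
move=> /leq_trans h1 /h1; rewrite expnMn -/N expnS leq_pmul2r ?expn_gt0 //.
by rewrite ltnn.
Qed.

Section CoarseMaps.
Variable R : realType.
Local Notation C := R[i].

(** Boxes replace norms: a bound on all coordinates is what the change to
    Jordan coordinates and the passage to real and imaginary parts preserve up
    to constants. *)
Definition coarse n n' (X : jordan_dynamics R n) (Y : jordan_dynamics R n')
    (F : 'cV[C]_n -> 'cV[C]_n') (K c : R) :=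
  forall m p q D, 0 <= D -> box (dyn X m *m (p - q)) D ->
    box (dyn Y m *m (F p - F q)) (K * D + c).

(** The additive constant is harmless because [rate r k] is bounded below by a
    positive constant when [r > 1]. *)
Lemma slow_coarse n n' (X : jordan_dynamics R n) (Y : jordan_dynamics R n')
    F K c r k p q : 0 <= K -> 0 <= c -> coarse X Y F K c -> 1 < r ->
  slow X r k (p - q) -> slow Y r k (F p - F q).
Proof.
move=> K0 c0 XY r1 [d d0 hd]; have r0 : 0 < r by apply: lt_trans r1.
have [|e e0 he] := @dominated_rate R 1 1 r k ltr01 r0.
  by rewrite /growth_le r1.
exists (K * d + c * e) => [|m]; first by rewrite addr_ge0 ?mulr_ge0.
have rg := rate_ge0 k m r0.
move=> i; apply: le_trans (XY m p q _ (mulr_ge0 d0 rg) (hd m) i) _.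
rewrite mulrDl -!mulrA lerD2l ler_peMr // -?mulrA //.
by have := he m; rewrite rateS /growth expr0 expr1n mulr1.
Qed.

Definition part (b : bool) (z : C) : R := if b then complex.Re z else complex.Im z.

Lemma partB b z w : part b (z - w) = part b z - part b w.
Proof. by case: b z w => -[a b] [d e]. Qed.

Lemma part_le b z : `|part b z| <= normc z.
Proof. by case: b; [apply: Re_le_normc|apply: Im_le_normc]. Qed.

(** Restrict [F] to the coordinate subspace of the flag of [X].  Differences of
    images are slow, so they are supported on the flag of [Y] and are controlled
    by the coordinates there; [coarse_card] applies to the real and imaginary
    parts of both sets of coordinates, which doubles the two cardinals. *)
Lemma flag_card_le n n' (X : jordan_dynamics R n) (Y : jordan_dynamics R n')
    F G (K c K' c' r : R) k : 0 <= K -> 0 <= c -> coarse X Y F K c ->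
    0 <= K' -> 0 <= c' -> coarse Y X G K' c' -> cancel F G -> 1 < r ->
  (#|[pred t : jordan_index (blocks X) | in_flag r k t]|
     <= #|[pred t : jordan_index (blocks Y) | in_flag r k t]|)%N.
Proof.
move=> K0 c0 XY K'0 c'0 YX FG r1; have r0 : 0 < r by apply: lt_trans r1.
pose T1 := ({t : jordan_index (blocks X) | in_flag r k t} * bool)%type.
pose T2 := ({t : jordan_index (blocks Y) | in_flag r k t} * bool)%type.
suff : (#|{: T1}| <= #|{: T2}|)%N.
  by rewrite !card_prod !card_sig card_bool leq_pmul2r.
pose xx (x : T1 -> R) u : C :=
  if insub u is Some t then Complex (x (t, true)) (x (t, false)) else 0.
pose V x := \sum_u xx x u *: dual u.
have coV x u : jcoord (V x) u = xx x u by exact: jcoord_sum.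
pose h x (j : T2) : R := part j.2 (jcoord (F (V x)) (val j.1)).
have [a1 a10 ha1] := box_jcoord X; have [a2 a20 ha2] := jcoord_box X.
have [b1 b10 hb1] := box_jcoord Y; have [b2 b20 hb2] := jcoord_box Y.
apply: (@coarse_card R _ _ h (b2 * (K * (a1 * 2))) (b2 * c)
          (a2 * (K' * (b1 * 2))) (a2 * c')); rewrite ?mulr_ge0 //.
- move=> x y D D0 xy [u b]; rewrite /h /= -partB -jcoordB.
  have D2 : 0 <= 2 * D by rewrite mulr_ge0.
  apply: le_trans (part_le _ _) _.
  have -> : b2 * (K * (a1 * 2)) * D + b2 * c = b2 * (K * (a1 * (2 * D)) + c) by ring.
  apply: hb2; first by rewrite addr_ge0 ?mulr_ge0.
  rewrite -[F _ - _]mul1mx -(dyn0 Y); apply: XY; first by rewrite !mulr_ge0.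
  rewrite dyn0 mul1mx; apply: ha1 => // t; rewrite jcoordB !coV /xx.
  case: insubP => [t' _ _|_]; last by rewrite subrr ComplexField.Normc.normc0 mulr_ge0.
  apply: le_trans (normc_le_ReIm _) _; rewrite mulr_natl mulr2n /=.
  by rewrite lerD // ?(xy (t', true)) ?(xy (t', false)).
move=> x y D D0 xy [u b].
have D2 : 0 <= 2 * D by rewrite mulr_ge0.
have Vs : slow X r k (V x - V y).
  apply: slow_of_flag => // t nt; rewrite jcoordB !coV /xx insubF ?subrr //.
  exact: negbTE.
have Fs := slow_coarse K0 c0 XY r1 Vs.
have bF : box (F (V x) - F (V y)) (b1 * (2 * D)).
  apply: hb1 => // t; have [ft|nft] := boolP (in_flag r k t); last first.
    by rewrite (flag_of_slow r0 Fs nft) ComplexField.Normc.normc0.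
  apply: le_trans (normc_le_ReIm _) _; rewrite mulr_natl mulr2n.
  have := xy (exist _ t ft, true); have := xy (exist _ t ft, false).
  by rewrite /h /= -!(partB true) -!(partB false) -!jcoordB /part => e1 e2; rewrite lerD.
have bV : box (V x - V y) (K' * (b1 * (2 * D)) + c').
  rewrite -[V x - _]mul1mx -(dyn0 X) -[V x]FG -[V y]FG; apply: YX.
    by rewrite !mulr_ge0.
  by rewrite dyn0 mul1mx.
have -> : a2 * (K' * (b1 * 2)) * D + a2 * c' = a2 * (K' * (b1 * (2 * D)) + c') by ring.
apply: le_trans (ha2 _ _ _ bV (val u)); last by rewrite addr_ge0 ?mulr_ge0.
rewrite jcoordB !coV /xx valK; apply: le_trans (part_le b _).
by case: b.
Qed.

End CoarseMaps.

(** * Powers of a matrix and of its inverse *)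

Section PowerDynamics.
Variable R : realType.
Local Notation C := R[i].

(** The common part of the two cases: [b m l] is the absolute value of the
    binomial coefficient and [e] its sign. *)
Lemma coef_bounds (a : C) (b : nat -> nat -> nat) e l :
    (exists k, forall m, (b m l <= k * m.+1 ^ l)%N) ->
    (forall m, 'C(m, l) <= b m l)%N -> normc e = 1 ->
  (exists2 c : R, 0 <= c & forall m,
     normc (e * (b m l)%:R * a ^- l) <= c * m.+1%:R ^+ l) /\
  (a != 0 -> exists2 c : R, 0 <= c & forall m, (l <= m)%N ->
     m.+1%:R ^+ l <= c * normc (e * (b m l)%:R * a ^- l)).
Proof.
move=> [k bk] bl e1.
have nE m : normc (e * (b m l)%:R * a ^- l) = (b m l)%:R * normc (a ^- l).
  by rewrite !ComplexField.Normc.normcM e1 mul1r normc_nat.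
split.
  exists (k%:R * normc (a ^- l)) => [|m]; first by rewrite mulr_ge0 ?normc_ge0.
  rewrite nE mulrAC ler_wpM2r ?normc_ge0 // -natrX -natrM ler_nat.
  exact: bk.
move=> a0; set w := (l.+1 ^ l * l`!)%N.
have an0 : 0 < normc (a ^- l) by rewrite normc_gt0 invr_eq0 expf_eq0 (negPf a0) andbF.
exists (w%:R / normc (a ^- l)) => [|m lm]; first by rewrite divr_ge0 ?normc_ge0.
rewrite nE mulrA mulrAC mulfVK ?gt_eqF // -natrM -natrX ler_nat.
by apply: leq_trans (expn_le_bin lm) _; rewrite leq_mul2l bl orbT.
Qed.

Lemma backward_coef_le l : exists k, forall m, ('C((m + l).-1, l) <= k * m.+1 ^ l)%N.
Proof.
exists (l.+1 ^ l)%N => m; rewrite -expnMn.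
by apply: leq_trans (bin_le_expn _ _) _; apply: leq_expn2r; nia.
Qed.

Lemma backward_coef_ge m l : ('C(m, l) <= 'C((m + l).-1, l))%N.
Proof. by case: l => [|l]; rewrite ?bin0 // leq_bin2l // addnS leq_addr. Qed.

Lemma forward_dynamics n (A : 'M[C]_n) (D : nat -> 'M[C]_n) s
    (p : nat -> nat -> 'rV[C]_n) :
    (forall b, b \in s -> b.1 != 0) -> jordan_size s = n ->
    (forall i j, p i j *m A = (block s i).1 *: p i j + p i j.+1) ->
    (forall i j, ((block s i).2 <= j)%N -> p i j = 0) ->
    (forall x : 'cV[C]_n, (forall i j, p i j *m x = 0) -> x = 0) ->
    D 0%N = 1%:M -> (forall m, D m.+1 = A *m D m) ->
  exists X : jordan_dynamics R n,
    [/\ blocks X = s, dyn X = D & forall i, mult X i = (block s i).1].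
Proof.
move=> s0 sz pA p0 sep D0 DS; have [g gp] := jordan_basis_dual sz p0 sep.
have nz i : (i < size s)%N -> (block s i).1 != 0 by move=> si; rewrite s0 ?mem_nth.
pose a i := (block s i).1.
pose cf i m l := 1 * 'C(m, l)%:R * a i ^- l.
have cb i l := coef_bounds (a i) (ex_intro _ 1%N
    (fun m => leq_trans (bin_le_expn m l) (eq_leq (esym (mul1n _)))))
  (fun m => leqnn 'C(m, l)) (ComplexField.Normc.normc1 R).
have dE m (v : 'cV[C]_n) i j : (p i j *m (D m *m v)) 0 0 = a i ^+ m *
    \sum_(l < (block s i).2) cf i m l * (p i (j + l) *m v) 0 0.
  have [si|si] := ltnP i (size s); last first.
    by rewrite p0 nth_default // mul0mx mxE big_ord0 mulr0.
  rewrite (@forward_orbit _ (a i) (block s i).2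
     (fun m j => (p i j *m (D m *m v)) 0 0)) ?nz // => [|{}m {}j kj|{}m {}j].
  - by congr (_ * _); apply: eq_bigr => l _; rewrite D0 mul1mx /cf mul1r.
  - by rewrite p0 // mul0mx mxE.
  by rewrite DS -mulmxA mulmxA pA mulmxDl -scalemxAl !mxE.
exists (@JordanDynamics R n D s p g a cf D0 p0 sep gp dE nz
  (fun i l => proj1 (cb i l)) (fun i l si => proj2 (cb i l) (nz i si))).
by split.
Qed.

Lemma backward_dynamics n (A : 'M[C]_n) (D : nat -> 'M[C]_n) s
    (p : nat -> nat -> 'rV[C]_n) :
    (forall b, b \in s -> b.1 != 0) -> jordan_size s = n ->
    (forall i j, p i j *m A = (block s i).1 *: p i j + p i j.+1) ->
    (forall i j, ((block s i).2 <= j)%N -> p i j = 0) ->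
    (forall x : 'cV[C]_n, (forall i j, p i j *m x = 0) -> x = 0) ->
    D 0%N = 1%:M -> (forall m, A *m D m.+1 = D m) ->
  exists X : jordan_dynamics R n,
    [/\ blocks X = s, dyn X = D & forall i, mult X i = (block s i).1^-1].
Proof.
move=> s0 sz pA p0 sep D0 DS; have [g gp] := jordan_basis_dual sz p0 sep.
have nz i : (i < size s)%N -> (block s i).1 != 0 by move=> si; rewrite s0 ?mem_nth.
have nzV i : (i < size s)%N -> (block s i).1^-1 != 0.
  by move=> si; rewrite invr_eq0 nz.
pose a i := (block s i).1.
pose cf i m l := (-1) ^+ l * 'C((m + l).-1, l)%:R * a i ^- l.
have sg l : normc ((-1) ^+ l : C) = 1.
  by rewrite normcX normcN ComplexField.Normc.normc1 expr1n.
have cb i l := @coef_bounds (a i) (fun m l => 'C((m + l).-1, l)) _ l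
  (backward_coef_le l) (fun m => backward_coef_ge m l) (sg l).
have dE m (v : 'cV[C]_n) i j : (p i j *m (D m *m v)) 0 0 = (a i)^-1 ^+ m *
    \sum_(l < (block s i).2) cf i m l * (p i (j + l) *m v) 0 0.
  have [si|si] := ltnP i (size s); last first.
    by rewrite p0 nth_default // mul0mx mxE big_ord0 mulr0.
  rewrite (@backward_orbit _ (a i) (block s i).2
     (fun m j => (p i j *m (D m *m v)) 0 0)) ?nz // => [|{}m {}j kj|{}m {}j].
  - rewrite exprVn; congr (_ * _); apply: eq_bigr => l _; rewrite D0 mul1mx //.
  - by rewrite p0 // mul0mx mxE.
  by rewrite -(DS m) -mulmxA [in RHS]mulmxA pA mulmxDl -scalemxAl !mxE.
exists (@JordanDynamics R n D s p g (fun i => (a i)^-1) cf D0 p0 sep gp dE nzV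
  (fun i l => proj1 (cb i l)) (fun i l si => proj2 (cb i l) (nz i si))).
by split.
Qed.

End PowerDynamics.

(** * Recovering the blocks from the dimensions *)

Section Weights.
Variable R : realType.

(** The contribution of a block to the dimension of a flag. *)
Definition weight (r : R) k (b : R * nat) : nat :=
  (\sum_(j < b.2) growth_le b.1 j.+1 r k)%N.

Lemma weightS r k b : weight r k.+1 b = (weight r k b + (b.1 == r) && (k < b.2))%N.
Proof.
have -> : ((b.1 == r) && (k < b.2) =
    \sum_(j < b.2) ((b.1 == r) && (j == k :> nat)) :> nat)%N.
  have [kb|bk] := ltnP k b.2; last first.
    rewrite andbF big1 // => j _; rewrite (_ : (j == k :> nat) = false) ?andbF //.
    by apply/negP => /eqP jk; move: (ltn_ord j); rewrite jk ltnNge bk.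
  rewrite (bigD1 (Ordinal kb)) //= eqxx big1 ?addn0 // => j.
  by rewrite -val_eqE /= => /negPf ->; rewrite andbF.
rewrite /weight -big_split; apply: eq_bigr => j _ /=.
rewrite /growth_le; case: ltgtP => //= _.
by rewrite ltnS leq_eqVlt; case: ltngtP.
Qed.

Lemma card_flag n (X : jordan_dynamics R n) (r : R) k :
  #|[pred t : jordan_index (blocks X) | in_flag r k t]| =
  (\sum_(i < size (blocks X)) weight r k (normc (mult X i), (block (blocks X) i).2))%N.
Proof.
rewrite -sum1_card big_mkcond /=.
rewrite /weight /= sig_big_dep /=; apply: eq_bigr => t _.
by transitivity (in_flag r k t : nat) => //; rewrite inE; case: in_flag.
Qed.

Lemma sum_weight_count (T : Type) (S : seq T) (f : T -> R * nat) r k :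
  (\sum_(b <- S) weight r k.+1 (f b) =
   \sum_(b <- S) weight r k (f b) + count (fun b => ((f b).1 == r) && (k < (f b).2)) S)%N.
Proof.
rewrite -sum1_count [X in (_ + X)%N]big_mkcond -big_split; apply: eq_bigr => b _ /=.
by rewrite weightS; case: (_ && _).
Qed.

(** Increasing [k] by one adds to the sum of weights the number of blocks of
    modulus [r] and size greater than [k].  Differences of these numbers count
    the blocks of each size. *)
Lemma perm_eq_of_weights (S S' : seq (R * nat)) :
    (forall b, b \in S ++ S' -> [/\ 0 < b.1, b.1 != 1 & (0 < b.2)%N]) ->
    (forall r k, 1 < r -> (\sum_(b <- S) weight r k b = \sum_(b <- S') weight r k b)%N) ->
    (forall r k, 1 < r -> (\sum_(b <- S) weight r k (b.1^-1, b.2) =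
                      \sum_(b <- S') weight r k (b.1^-1, b.2))%N) ->
  perm_eq S S'.
Proof.
move=> SS' W V; apply/allP => -[rho K] /SS' /= [rho0 rho1 K0].
have E k : count (fun b => (b.1 == rho) && (k < b.2)%N) S =
           count (fun b => (b.1 == rho) && (k < b.2)%N) S'.
  have [rl|rg|re] := ltgtP rho 1; last by rewrite re eqxx in rho1.
    have rV : 1 < rho^-1 by rewrite invf_gt1.
    have := V _ k.+1 rV; rewrite !(sum_weight_count _ (fun b => (b.1^-1, b.2))) V //=.
    move/addnI; 
    by rewrite !(eq_count (a2 := fun b => (b.1 == rho) && (k < b.2)%N)) // => b;
      rewrite /= (inj_eq invr_inj).
  have := W _ k.+1 rg; rewrite !(sum_weight_count _ id) W //=.
  by move/addnI.
case: K K0 => // K _.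
have cE (S0 : seq (R * nat)) : (count_mem (rho, K.+1) S0 +
    count (fun b => (b.1 == rho) && (K.+1 < b.2)%N) S0 =
    count (fun b => (b.1 == rho) && (K < b.2)%N) S0)%N.
  rewrite -count_predUI [X in (_ + X)%N](_ : _ = 0%N) ?addn0.
    apply: eq_count => -[x y] /=; rewrite xpair_eqE.
    by case: (x == rho) => //=; rewrite [RHS]leq_eqVlt eq_sym.
  apply/eqP; rewrite -leqn0 leqNgt -has_count; apply/hasPn => -[x y] _ /=.
  by rewrite xpair_eqE; case: (y =P K.+1) => [->|_]; rewrite ?ltnn ?andbF.
rewrite /= -(eqn_add2r (count (fun b => (b.1 == rho) && (K.+1 < b.2)%N) S)).
by rewrite cE (E K.+1) cE E.
Qed.

End Weights.

(** * From real to complex maps *)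

Section Complexify.
Variable R : realType.
Local Notation C := R[i].

Definition re_cv n (v : 'cV[C]_n) : 'cV[R]_n := map_mx (@complex.Re R) v.
Definition im_cv n (v : 'cV[C]_n) : 'cV[R]_n := map_mx (@complex.Im R) v.

Definition split_map n (f : 'cV[R]_n -> 'cV[R]_n) (v : 'cV[C]_n) : 'cV[C]_n :=
  \col_i Complex (f (re_cv v) i 0) (f (im_cv v) i 0).

Lemma split_map_cancel n (f g : 'cV[R]_n -> 'cV[R]_n) :
  cancel f g -> cancel (split_map f) (split_map g).
Proof.
move=> fg v; apply/colP => i; rewrite /split_map mxE.
have -> : re_cv (\col_i Complex (f (re_cv v) i 0) (f (im_cv v) i 0)) = f (re_cv v).
  by apply/colP => j; rewrite !mxE.
have -> : im_cv (\col_i Complex (f (re_cv v) i 0) (f (im_cv v) i 0)) = f (im_cv v).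
  by apply/colP => j; rewrite !mxE.
by rewrite !fg !mxE; case: (v i 0).
Qed.

Lemma complexify_mulE n (A : 'M[R]_n) (v : 'cV[C]_n) i :
  (complexify A *m v) i 0 = Complex ((A *m re_cv v) i 0) ((A *m im_cv v) i 0).
Proof.
rewrite !mxE.
elim/big_rec3: _ => // j x y z _ ->; rewrite !mxE.
by case: (v j 0) => a b; apply/eqP; rewrite eq_complex /= !mul0r subr0 addr0 !eqxx.
Qed.

Lemma re_cvB n (v w : 'cV[C]_n) : re_cv (v - w) = re_cv v - re_cv w.
Proof. by apply/colP => i; rewrite !mxE; case: (v i 0) (w i 0) => a b []. Qed.

Lemma im_cvB n (v w : 'cV[C]_n) : im_cv (v - w) = im_cv v - im_cv w.
Proof. by apply/colP => i; rewrite !mxE; case: (v i 0) (w i 0) => a b []. Qed.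

Lemma entry_le_norm n (v : 'cV[R]_n) i : `|v i 0| <= euclidean_norm v.
Proof.
rewrite -sqrtr_sqr ler_wsqrtr // (bigD1 i) //= lerDl.
by apply: sumr_ge0 => j _; apply: sqr_ge0.
Qed.

Lemma norm_le_box n (v : 'cV[R]_n) D : 0 <= D -> (forall i, `|v i 0| <= D) ->
  euclidean_norm v <= n.+1%:R * D.
Proof.
move=> D0 vD; have nD : 0 <= n.+1%:R * D by rewrite mulr_ge0.
rewrite -[leRHS]ger0_norm // -sqrtr_sqr ler_wsqrtr //.
apply: (@le_trans _ _ (\sum_(i < n) D ^+ 2)).
  by apply: ler_sum => i _; rewrite -real_normK ?num_real // lerXn2r ?nnegrE.
rewrite sumr_const card_ord -[leLHS]mulr_natl exprMn ler_wpM2r ?sqr_ge0 //.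
by rewrite -natrX ler_nat; nia.
Qed.

(** The sequence of times [tau] is [m] or [- m]. The factor [n.+1] compares the
    Euclidean norm with the largest coordinate, and the factor [2] adds up the
    real and imaginary parts. *)
Lemma coarse_of_dist n (M N : R -> 'M[R]_n) (tau : nat -> R)
    (X Y : jordan_dynamics R n) (f : 'cV[R]_n -> 'cV[R]_n) (K c : R) :
    0 <= K -> 0 <= c ->
    (forall m, dyn X m = complexify (M (tau m))) ->
    (forall m, dyn Y m = complexify (N (tau m))) ->
    (forall t p q, dist N t (f p) (f q) <= K * dist M t p q + c) ->
  coarse X Y (split_map f) (2 * (K * n.+1%:R)) (2 * c).
Proof.
move=> K0 c0 XM YN h m p q D D0.
have main (x y : 'cV[R]_n) : (forall i, `|(M (tau m) *m (x - y)) i 0| <= D) ->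
    forall i, `|(N (tau m) *m (f x - f y)) i 0| <= K * n.+1%:R * D + c.
  move=> hx i; apply: le_trans (entry_le_norm _ _) _.
  have := h (- tau m) x y; rewrite /dist opprK => /le_trans; apply.
  by rewrite -mulrA lerD2r ler_wpM2l // norm_le_box.
rewrite XM YN => hb i.
have hr j : `|(M (tau m) *m (re_cv p - re_cv q)) j 0| <= D.
  apply: le_trans (hb j); rewrite -re_cvB complexify_mulE.
  exact: (Re_le_normc (Complex _ _)).
have hi j : `|(M (tau m) *m (im_cv p - im_cv q)) j 0| <= D.
  apply: le_trans (hb j); rewrite -im_cvB complexify_mulE.
  exact: (Im_le_normc (Complex _ _)).
have re_s (g : 'cV[R]_n -> 'cV[R]_n) v : re_cv (split_map g v) = g (re_cv v).
  by apply/colP => j; rewrite !mxE.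
have im_s (g : 'cV[R]_n -> 'cV[R]_n) v : im_cv (split_map g v) = g (im_cv v).
  by apply/colP => j; rewrite !mxE.
rewrite complexify_mulE re_cvB im_cvB !re_s !im_s.
apply: le_trans (normc_le_ReIm _) _ => /=.
have := main _ _ hr i; have := main _ _ hi i; lra.
Qed.

End Complexify.

(** * Sorted lists of blocks *)

Lemma block_ge_total (R : realType) : total (@block_ge R).
Proof.
move=> [a k] [b l]; rewrite /block_ge /=; case: ltgtP => //= _.
exact: leq_total.
Qed.

Lemma block_ge_trans (R : realType) : transitive (@block_ge R).
Proof.
move=> [b l] [a k] [c m]; rewrite /block_ge /=.
case: (ltgtP b a) => //= [ba _|->].
  case: (ltgtP c b) => //= [cb|->] _; last by rewrite ba.
  by rewrite (lt_trans cb ba).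
by move=> lk; case: (ltgtP c a) => //= _ ml; rewrite (leq_trans ml lk).
Qed.

Lemma block_ge_anti (R : realType) : antisymmetric (@block_ge R).
Proof.
move=> [a k] [b l]; rewrite /block_ge /=; case: (ltgtP a b) => //= -> /=.
by rewrite andbC -eqn_leq => /eqP ->.
Qed.

Lemma jordan_size_abs_blocks (R : realType) (s : seq (R[i] * nat)) :
  jordan_size (abs_blocks s) = jordan_size s.
Proof.
rewrite !jordan_size_sum (perm_big [seq (normc b.1, b.2) | b <- s]) /=.
  by rewrite big_map.
by rewrite /abs_blocks perm_sort.
Qed.

(** * One-parameter subgroups *)

Lemma one_parameter0 (R : realType) n (M : R -> 'M[R]_n) :
  one_parameter_subgroup M -> M 0 = 1%:M.
Proof.
case=> uM DM _; have := DM 0 0; rewrite addr0 => /(congr1 (mulmx (invmx (M 0)))).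
by rewrite mulVmx // mulKmx.
Qed.

(** One Jordan basis of [M 1] serves both directions of time, so that both
    cardinals refer to the same list of blocks. *)
Lemma subgroup_dynamics (R : realType) n (M : R -> 'M[R]_n) :
    one_parameter_subgroup M -> no_unit_circle_eigenvalue (M 1) ->
  exists (s : seq (R[i] * nat)) (X Y : jordan_dynamics R n),
   [/\ jordan_form_of (complexify (M 1)) s /\ jordan_size s = n,
       forall b, b \in s -> [/\ 0 < normc b.1, normc b.1 != 1 & (0 < b.2)%N],
       forall m, dyn X m = complexify (M m%:R) /\ dyn Y m = complexify (M (- m%:R)),
       forall r k, #|[pred t : jordan_index (blocks X) | in_flag r k t]| =
         (\sum_(b <- [seq (normc b.1, b.2) | b <- s]) weight r k b)%N
     & forall r k, #|[pred t : jordan_index (blocks Y) | in_flag r k t]| =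
         (\sum_(b <- [seq (normc b.1, b.2) | b <- s]) weight r k (b.1^-1, b.2))%N].
Proof.
move=> hM nuM; have [uM DM _] := hM.
have [s [p [es sz pA p0 sep]]] := jordan_basis (complexify (M 1)).
have s0 b : b \in s -> b.1 != 0.
  case/es => _ /eigenvalueP[v vA vn]; apply: contraNneq vn => b0.
  move: vA; rewrite b0 scale0r => /(congr1 (mulmx^~ (invmx (complexify (M 1))))).
  by rewrite mul0mx mulmxK ?map_unitmx // => ->.
have [X [Xs XD Xm]] : exists X : jordan_dynamics R n, [/\ blocks X = s,
   dyn X = (fun m => complexify (M m%:R)) & forall i, mult X i = (block s i).1].
  apply: (forward_dynamics s0 sz pA p0 sep) => [|m].
    by rewrite one_parameter0 // /complexify map_scalar_mx.
  by rewrite -map_mxM -DM -natr1 addrC.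
have [Y [Ys YD Ym]] : exists X : jordan_dynamics R n, [/\ blocks X = s,
   dyn X = (fun m => complexify (M (- m%:R))) & forall i, mult X i = (block s i).1^-1].
  apply: (backward_dynamics s0 sz pA p0 sep) => [|m].
    by rewrite oppr0 one_parameter0 // /complexify map_scalar_mx.
  by rewrite -map_mxM -DM -natr1 opprD addrC subrK.
exists s, X, Y; split.
- split=> //; apply: jordan_form_of_basis (fun b bs => proj1 (es b bs)) sz pA p0 sep.
- move=> b bs; have [b2 ev] := es b bs; split => //; last exact: nuM.
  by rewrite normc_gt0 s0.
- by move=> m; rewrite XD YD.
- move=> r k; rewrite card_flag big_map (big_nth (0, 0%N)) big_mkord Xs.
  by apply: eq_bigr => i _; rewrite Xm.
- move=> r k; rewrite card_flag big_map (big_nth (0, 0%N)) big_mkord Ys.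
  by apply: eq_bigr => i _; rewrite Ym ComplexField.Normc.normcV.
Qed.

Theorem theorem5p11 (R : realType) (n : nat) (M N : R -> 'M[R]_n)
  (hM : one_parameter_subgroup M) (hN : one_parameter_subgroup N)
  (hM1 : no_unit_circle_eigenvalue (M 1))
  (hN1 : no_unit_circle_eigenvalue (N 1))
  (hf : exists (f : 'cV[R]_n -> 'cV[R]_n) (K C : R),
    [/\ bijective f, 1 <= K, 0 <= C
      & forall (t : R) (p q : 'cV[R]_n),
          - C + K^-1 * dist M t p q <= dist N t (f p) (f q)
            <= K * dist M t p q + C]) :
  same_abs_jordan_form (M 1) (N 1).
Proof.
have [s [X [Y [[Js sz] sP XY cX cY]]]] := subgroup_dynamics hM hM1.
have [s' [X' [Y' [[Js' sz'] sP' XY' cX' cY']]]] := subgroup_dynamics hN hN1.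
case: hf => f [K [c [[g fg gf] K1 c0 qi]]].
have Kp : 0 < K by apply: lt_le_trans K1.
have K0 := ltW Kp.
have up t p q : dist N t (f p) (f q) <= K * dist M t p q + c.
  by case/andP: (qi t p q).
have low t p q : dist M t (g p) (g q) <= K * dist N t p q + K * c.
  have /andP[+ _] := qi t (g p) (g q); rewrite !gf addrC lerBlDr.
  by rewrite ler_pdivrMl // mulrDr.
have Kn : 0 <= 2 * (K * n.+1%:R) by rewrite !mulr_ge0.
have c20 : 0 <= 2 * c by rewrite mulr_ge0.
have Kc20 : 0 <= 2 * (K * c) by rewrite !mulr_ge0.
have perm : perm_eq [seq (normc b.1, b.2) | b <- s] [seq (normc b.1, b.2) | b <- s'].
  have DX m := proj1 (XY m); have DY m := proj2 (XY m).
  have DX' m := proj1 (XY' m); have DY' m := proj2 (XY' m).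
  apply: perm_eq_of_weights => [b|r k r1|r k r1].
  - by rewrite mem_cat => /orP[] /mapP[a /[swap] -> /=]; [apply: sP|apply: sP'].
  - have XX := coarse_of_dist K0 c0 DX DX' up.
    have XX' := coarse_of_dist K0 (mulr_ge0 K0 c0) DX' DX low.
    rewrite -cX -cX'; apply/eqP; rewrite eqn_leq.
    rewrite (flag_card_le _ Kn c20 XX Kn Kc20 XX' (split_map_cancel fg) r1).
    by rewrite (flag_card_le _ Kn Kc20 XX' Kn c20 XX (split_map_cancel gf) r1).
  have YY := coarse_of_dist K0 c0 DY DY' up.
  have YY' := coarse_of_dist K0 (mulr_ge0 K0 c0) DY' DY low.
  rewrite -cY -cY'; apply/eqP; rewrite eqn_leq.
  rewrite (flag_card_le _ Kn c20 YY Kn Kc20 YY' (split_map_cancel fg) r1).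
  by rewrite (flag_card_le _ Kn Kc20 YY' Kn c20 YY (split_map_cancel gf) r1).
have abs_eq : abs_blocks s' = abs_blocks s.
  apply/esym/perm_sortP => //.
  - exact: block_ge_total.
  - exact: block_ge_trans.
  - exact: block_ge_anti.
have e : jordan_size (abs_blocks s) = n by rewrite jordan_size_abs_blocks.
exists (castmx (e, e) (jordan_mx (abs_blocks s))); split.
  by exists s => //; exists e.
by exists s' => //; rewrite abs_eq; exists e.
Qed.
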